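(* Let $(\mathcal A,\mathfrak g)$ be a derivation based calculus and let $\nabla^0$ be a regular left $\mathfrak g$-connection on $\Omega^1_{\mathfrak g}$. Let $\mathcal B$ be the set of regular biadditive maps $\beta:\Omega^1_{\mathfrak g}\times\mathfrak g\to\Omega^1_{\mathfrak g}$ such that $\beta(a\omega,\partial)=a\,\beta(\omega,\partial)$ for all $a\in\mathcal A$, $\beta(\omega,z\partial)=z\,\beta(\omega,\partial)$ whenever $z\in Z(\mathcal A)$ and $\partial,z\partial\in\mathfrak g$, and $\wedge\beta=0$. Then the map $$\psi_{\nabla^0}:\mathcal B\to\{\text{torsion free left }\mathfrak g\text{-connections on }\Omega^1_{\mathfrak g}\},\qquad \psi_{\nabla^0}(\beta)=\tfrac12\big(d+s(\nabla^0)\big)+\beta,$$ is a bijection.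
   Context: Setting. $\mathcal A$ is a unital associative $*$-algebra over $\mathbb C$ with center $Z(\mathcal A)$. $\mathrm{Der}(\mathcal A)$ is the complex Lie algebra of derivations of $\mathcal A$, with $(z\partial)(a)=z\,\partial(a)$ for $z\in Z(\mathcal A)$ and $\partial^*(a)=\partial(a^* )^*$. $\mathfrak g\subseteq\mathrm{Der}(\mathcal A)$ is a complex Lie subalgebra closed under $*$ (not necessarily a $Z(\mathcal A)$-submodule). Forms. $\bar\Omega^1_{\mathfrak g}$ is the set of additive maps $\omega:\mathfrak g\to\mathcal A$ with $\omega(z\partial)=z\,\omega(\partial)$ whenever $z\in Z(\mathcal A)$, $\partial\in\mathfrak g$ and $z\partial\in\mathfrak g$. It is an $\mathcal A$-bimodule by $(a\omega b)(\partial)=a\,\omega(\partial)\,b$. For $a\in\mathcal A$, $da(\partial)=\partial(a)$; for $\omega\in\bar\Omega^1_{\mathfrak g}$, $d\omega(\partial_0,\partial_1)=\partial_0\omega(\partial_1)-\partial_1\omega(\partial_0)-\omega([\partial_0,\partial_1])$. $\Omega^1_{\mathfrak g}\subseteq\bar\Omega^1_{\mathfrak g}$ is the sub-bimodule of finite sums of elements $a_0\,da_1$, $a_0,a_1\in\mathcal A$. Connections. A left $\mathfrak g$-connection on a left $\mathcal A$-module $M$ is a map $\nabla:M\times\mathfrak g\to M$, written $\nabla(m,\partial)=\nabla_\partial m$, additive in both arguments, with $\nabla_\partial(am)=a\nabla_\partial m+(\partial a)m$ for $a\in\mathcal A$, and $\nabla_{z\partial}m=z\nabla_\partial m$ for $z\in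 Z(\mathcal A)$ with $z\partial\in\mathfrak g$. $(\mathcal A,\mathfrak g)$ is a (left) derivation based calculus if there exists a left $\mathfrak g$-connection on $\Omega^1_{\mathfrak g}$. A connection $\nabla$ on $\Omega^1_{\mathfrak g}$ is torsion free if $(\nabla_{\partial_1}\omega)(\partial_2)-(\nabla_{\partial_2}\omega)(\partial_1)=d\omega(\partial_1,\partial_2)$ for all $\omega\in\Omega^1_{\mathfrak g}$, $\partial_1,\partial_2\in\mathfrak g$. Operators. Consider biadditive maps $\alpha:\Omega^1_{\mathfrak g}\times\mathfrak g\to\Omega^1_{\mathfrak g}$ that are $\mathbb C$-linear in the first argument and satisfy $\alpha(\omega,z\partial)=z\alpha(\omega,\partial)$ whenever $z\in Z(\mathcal A)$ and $z\partial\in\mathfrak g$ (connections are such maps). Put $\sigma(\alpha)(\omega,\partial)(\partial')=\alpha(\omega,\partial')(\partial)$, so $\sigma(\alpha)(\omega,\partial)\in\bar\Omega^1_{\mathfrak g}$. $\alpha$ is regular if $\sigma(\alpha)(\omega,\partial)\in\Omega^1_{\mathfrak g}$ for all $\omega\in\Omega^1_{\mathfrak g}$, $\partial\in\mathfrak g$. Put $\wedge\alpha=\alpha-\sigma(\alpha)$ and $s(\alpha)=\alpha+\sigma(\alpha)$. The exterior derivative is regarded as such a map by $d(\omega,\partial_1)(\partial_2)=d\omega(\partial_1,\partial_2)$. *)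

(* Defs.v *)
From HB Require Import structures.
From mathcomp Require Import all_boot all_order all_algebra.
From mathcomp Require Import boolp classical_sets functions reals.
From mathcomp Require Import complex.

Set Implicit Arguments.
Unset Strict Implicit.
Unset Printing Implicit Defensive.

Import GRing.Theory.
Local Open Scope classical_set_scope.
Local Open Scope complex_scope.
Local Open Scope ring_scope.

HB.mixin Record Algebra_isStarAlgebra (R : realType) A
    of GRing.Algebra R[i] A := {
  star : A -> A ;
  starD : forall a b : A, star (a + b) = star a + star b ;
  starZ : forall (c : R[i]) (a : A), star (c *: a) = c^* *: star a ;
  starM : forall a b : A, star (a * b) = star b * star a ;
  starK : involutive star
}.

#[short(type="starAlgType")]
HB.structure Definition StarAlgebra (R : realType) :=
  {A of GRing.Algebra R[i] A & Algebra_isStarAlgebra R A}.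

Section Derivations.
Context {R : realType} {A : starAlgType R}.

Definition alg_center : set A := [set z | forall a, z * a = a * z].

Definition Der : set (A -> A) :=
  [set D | (forall (c : R[i]) (a b : A), D (c *: a + b) = c *: D a + D b) /\
           (forall a b : A, D (a * b) = D a * b + a * D b)].

Definition der_zmul (z : A) (D : A -> A) : A -> A := fun a => z * D a.

Definition der_star (D : A -> A) : A -> A := fun a => star (D (star a)).

Definition der_comm (D E : A -> A) : A -> A := fun a => D (E a) - E (D a).

End Derivations.

Record starLieSubalg (R : realType) (A : starAlgType R) := StarLieSubalg {
  lie_set : set (A -> A) ;
  lie_set_Der : lie_set `<=` Der ;
  lie_set0 : lie_set (fun=> 0) ;
  lie_setP : forall (c : R[i]) (D E : A -> A),
    lie_set D -> lie_set E -> lie_set (fun a => c *: D a + E a) ;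
  lie_set_comm : forall D E : A -> A,
    lie_set D -> lie_set E -> lie_set (der_comm D E) ;
  lie_set_star : forall D : A -> A, lie_set D -> lie_set (der_star D)
}.

Definition lie_pred (R : realType) (A : starAlgType R)
  (g : starLieSubalg A) : {pred A -> A} := fun D => `[< lie_set g D >].

Section Elements.
Context (R : realType) (A : starAlgType R) (g : starLieSubalg A).

Fact lie_pred_submod : submod_closed (lie_pred g).
Proof.
split=> [|c D E /asboolP gD /asboolP gE]; apply/asboolP; first exact: lie_set0.
exact: lie_setP.
Qed.

HB.instance Definition _ :=
  GRing.isSubmodClosed.Build R[i] (A -> A) (lie_pred g) lie_pred_submod.

(* The elements of g as a type, so that forms and connections are total
   functions on it. *)
Record lie_elt := LieElt {
  lie_fun :> A -> A ;
  lie_funP : lie_fun \in lie_pred g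
}.

HB.instance Definition _ := [isSub for lie_fun].
HB.instance Definition _ := [Choice of lie_elt by <:].
HB.instance Definition _ := [SubChoice_isSubLmodule of lie_elt by <:].

Lemma lie_elt_linear (D : lie_elt) (c : R[i]) (a b : A) :
  D (c *: a + b) = c *: D a + D b.
Proof. by case: D => D /= /asboolP /lie_set_Der []. Qed.

Lemma lie_elt_leibniz (D : lie_elt) (a b : A) : D (a * b) = D a * b + a * D b.
Proof. by case: D => D /= /asboolP /lie_set_Der []. Qed.

Fact lie_bracket_subproof (D E : lie_elt) : der_comm D E \in lie_pred g.
Proof.
by apply/asboolP/lie_set_comm; apply/asboolP; [case: D|case: E].
Qed.

Definition lie_bracket (D E : lie_elt) : lie_elt :=
  LieElt (lie_bracket_subproof D E).

End Elements.

Section Forms.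
Context (R : realType) (A : starAlgType R) (g : starLieSubalg A).
Local Notation G := (lie_elt g).

Definition Omega1bar : set (G -> A) :=
  [set w : G -> A | {morph w : D E / D + E} /\
    forall (z : A) (D : G) (zD : der_zmul z D \in lie_pred g),
      alg_center z -> w (LieElt zD) = z * w D].

Definition dform_lmul (a : A) (w : G -> A) : G -> A := fun D => a * w D.

Definition d0 (a : A) : G -> A := fun D => D a.

Definition d1 (w : G -> A) (D0 D1 : G) : A :=
  D0 (w D1) - D1 (w D0) - w (lie_bracket D0 D1).

Definition Omega1 : set (G -> A) :=
  [set w : G -> A | exists s : seq (A * A),
    w = \sum_(p <- s) dform_lmul p.1 (d0 p.2)].

Lemma Omega1D w v : Omega1 w -> Omega1 v -> Omega1 (w + v).
Proof. by move=> [s ->] [t ->]; exists (s ++ t); rewrite big_cat. Qed.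

Lemma Omega1_lmul a w : Omega1 w -> Omega1 (dform_lmul a w).
Proof.
move=> [s ->]; exists [seq (a * p.1, p.2) | p <- s]; rewrite big_map.
apply/funext => D; rewrite /dform_lmul !fct_sumE mulr_sumr.
by apply: eq_bigr => p _; rewrite mulrA.
Qed.

Lemma Omega1N w : Omega1 w -> Omega1 (- w).
Proof.
move=> /(Omega1_lmul (-1)); congr Omega1; apply/funext => D.
by rewrite /dform_lmul mulN1r.
Qed.

Lemma Omega1_adb a b : Omega1 (dform_lmul a (d0 b)).
Proof. by exists [:: (a, b)]; rewrite big_seq1. Qed.

Lemma Omega1_0 : Omega1 0.
Proof. by exists [::]; rewrite big_nil. Qed.

Lemma Omega1_bar : Omega1 `<=` Omega1bar.
Proof.
move=> _ [s ->]; split=> [D E|z D zD cz]; rewrite !fct_sumE.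
  rewrite -big_split; apply: eq_bigr => p _ /=.
  by rewrite /dform_lmul /d0 -mulrDr.
rewrite mulr_sumr; apply: eq_bigr => p _.
by rewrite /dform_lmul /d0 /= /der_zmul !mulrA cz.
Qed.

Lemma lie_eltD (D : G) (a b : A) : D (a + b) = D a + D b.
Proof. by have := lie_elt_linear D 1 a b; rewrite !scale1r. Qed.

Lemma lie_elt0 (D : G) : D 0 = 0.
Proof. by apply: (addrI (D 0)); rewrite -lie_eltD !addr0. Qed.

Lemma Omega1_d1 w D : Omega1 w -> Omega1 (d1 w D).
Proof.
move=> [s ->]; elim: s => [|[a b] s IHs].
  rewrite big_nil; suff -> : d1 0 D = 0 by exact: Omega1_0.
  by apply/funext => E; rewrite /d1 /= !lie_elt0 !subr0.
rewrite big_cons /=; set v := \sum_(_ <- _) _.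
suff -> : d1 (dform_lmul a (d0 b) + v) D =
    dform_lmul (D a) (d0 b) - dform_lmul 1 (d0 (a * D b))
    + dform_lmul a (d0 (D b)) + d1 v D.
  by do 3?[apply: Omega1D => //]; try apply: Omega1N; exact: Omega1_adb.
apply/funext => E.
have -> : (dform_lmul (D a) (d0 b) - dform_lmul 1 (d0 (a * D b))
    + dform_lmul a (d0 (D b)) + d1 v D) E =
    D a * E b - E (a * D b) + a * E (D b) + d1 v D E.
  by rewrite -[E (a * D b)]mul1r.
rewrite /d1.
have vE F : (dform_lmul a (d0 b) + v) F = a * F b + v F by [].
rewrite !vE !lie_eltD !lie_elt_leibniz /= /der_comm mulrBr.
rewrite !(opprD, opprK, addrA).
rewrite [LHS](ACl (1*4*3*6*9*(2*7)*(5*8)))/= addrN addNr !addr0.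
by rewrite subrK.
Qed.

Definition dform_pred : {pred G -> A} := fun w => `[< Omega1 w >].

Fact dform_pred_zmod : zmod_closed dform_pred.
Proof.
split=> [|w v /asboolP Ow /asboolP Ov]; apply/asboolP; first exact: Omega1_0.
by apply: Omega1D => //; exact: Omega1N.
Qed.

HB.instance Definition _ :=
  GRing.isZmodClosed.Build (G -> A) dform_pred dform_pred_zmod.

Record dform := DForm {
  dform_fun :> G -> A ;
  dform_funP : dform_fun \in dform_pred
}.

HB.instance Definition _ := [isSub for dform_fun].
HB.instance Definition _ := [Choice of dform by <:].
HB.instance Definition _ := [SubChoice_isSubZmodule of dform by <:].

Definition mkdform (w : G -> A) (Ow : Omega1 w) : dform := DForm (asboolT Ow).

Lemma dformP (w : dform) : Omega1 w.
Proof. by case: w => w /= /asboolP. Qed.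

Definition dform_scale (a : A) (w : dform) : dform :=
  mkdform (Omega1_lmul a (dformP w)).

Fact dform_scaleA a b w :
  dform_scale a (dform_scale b w) = dform_scale (a * b) w.
Proof. by apply/val_inj/funext => D /=; rewrite /dform_lmul mulrA. Qed.

Fact dform_scale1 : left_id 1 dform_scale.
Proof. by move=> w; apply/val_inj/funext => D /=; rewrite /dform_lmul mul1r. Qed.

Fact dform_scaleDr : right_distributive dform_scale +%R.
Proof. by move=> a w v; apply/val_inj/funext => D; exact: mulrDr. Qed.

Fact dform_scaleDl w : {morph dform_scale^~ w : a b / a + b}.
Proof. by move=> a b; apply/val_inj/funext => D; exact: mulrDl. Qed.

HB.instance Definition _ := GRing.Zmodule_isLmodule.Build A dform
  dform_scaleA dform_scale1 dform_scaleDr dform_scaleDl.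

End Forms.

Section Connections.
Context (R : realType) (A : starAlgType R) (g : starLieSubalg A).
Local Notation G := (lie_elt g).
Local Notation dform := (dform g).

Definition biadditive (M : zmodType) (nabla : M -> G -> M) : Prop :=
  (forall D, {morph nabla^~ D : m n / m + n}) /\
  (forall m, {morph nabla m : D E / D + E}).

Definition center_homogeneous (M : lmodType A) (nabla : M -> G -> M) : Prop :=
  forall (m : M) (z : A) (D : G) (zD : der_zmul z D \in lie_pred g),
    alg_center z -> nabla m (LieElt zD) = z *: nabla m D.

Definition left_connection (M : lmodType A) (nabla : M -> G -> M) : Prop :=
  [/\ biadditive nabla,
      forall (a : A) (m : M) (D : G),
        nabla (a *: m) D = a *: nabla m D + D a *: m &
      center_homogeneous nabla].

Definition derivation_based_calculus : Prop :=
  exists nabla : dform -> G -> dform, left_connection nabla.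

Definition torsion_free (nabla : dform -> G -> dform) : Prop :=
  forall (w : dform) (D1 D2 : G),
    nabla w D1 D2 - nabla w D2 D1 = d1 w D1 D2.

Definition torsion_free_connections : set (dform -> G -> dform) :=
  [set nabla | left_connection nabla /\ torsion_free nabla].

(* op_sigma, regular and op_wedge are meant for maps alpha that are biadditive,
   complex linear in the first argument and homogeneous for the center in the
   second one; connections and the elements of psi_domain below have these
   properties. *)
Definition op_sigma (alpha : dform -> G -> dform) : dform -> G -> (G -> A) :=
  fun w D D' => alpha w D' D.

Definition regular (alpha : dform -> G -> dform) : Prop :=
  forall (w : dform) (D : G), Omega1 (op_sigma alpha w D).

Definition op_wedge (alpha : dform -> G -> dform) : dform -> G -> (G -> A) :=
  fun w D => (alpha w D : G -> A) - op_sigma alpha w D.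

(* The operators sigma(alpha) and s(alpha) of a regular alpha, with values in
   Omega1. *)
Definition sigma_reg (alpha : dform -> G -> dform) (reg : regular alpha) :
  dform -> G -> dform := fun w D => mkdform (reg w D).

Definition sym_reg (alpha : dform -> G -> dform) (reg : regular alpha) :
  dform -> G -> dform := fun w D => alpha w D + sigma_reg reg w D.

Definition ext_d : dform -> G -> dform :=
  fun w D => mkdform (Omega1_d1 D (dformP w)).

Definition psi_domain : set (dform -> G -> dform) :=
  [set beta | [/\ regular beta,
                  biadditive beta,
                  forall (a : A) (w : dform) (D : G),
                    beta (a *: w) D = a *: beta w D,
                  center_homogeneous beta &
                  op_wedge beta = fun=> fun=> 0]].

(* The scalar 1/2 acts on forms through the left A-module structure, as
   (1/2) *: 1. *)
Definition psi (nabla0 : dform -> G -> dform) (reg : regular nabla0)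
    (beta : dform -> G -> dform) : dform -> G -> dform :=
  fun w D => (2^-1 : R[i])%:A *: (ext_d w D + sym_reg reg w D) + beta w D.

End Connections.

Arguments psi_domain {R A} g _.
Arguments torsion_free_connections {R A} g _.
Arguments Omega1bar {R A} g _.
Arguments Omega1 {R A} g _.

(* Main.v *)
(** Torsion freeness and the connection axioms are affine conditions, and the
    difference of two torsion free connections is left linear with vanishing
    wedge, hence lies in [psi_domain]. So it suffices that the value of [psi]
    at zero is itself a torsion free connection: the Leibniz defects of [d],
    [nabla0] and [sigma nabla0] add up to twice that of a connection, the
    symmetric part drops out of the torsion, and [d] is antisymmetric. *)
Require Import Defs.
From mathcomp Require Import all_boot all_order all_algebra.
From mathcomp Require Import boolp classical_sets functions reals.
From mathcomp Require Import complex.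

Import GRing.Theory Num.Theory.
Local Open Scope classical_set_scope.
Local Open Scope complex_scope.
Local Open Scope ring_scope.

Section ExteriorDerivative.
Context (R : realType) (A : starAlgType R) (g : starLieSubalg A).
Local Notation G := (lie_elt g).
Local Notation dform := (dform g).
Implicit Types (w v : dform) (D E F : G) (a z : A).

Lemma alg_center1 : alg_center (1 : A).
Proof. by move=> a; rewrite mul1r mulr1. Qed.

Lemma alg_centerN z : alg_center z -> alg_center (- z).
Proof. by move=> cz a; rewrite mulNr mulrN cz. Qed.

(** Apply [D] to [z * a = a * z]: the terms containing [D a] cancel because [z] is central. *)
Lemma lie_elt_center z D : alg_center z -> alg_center (D z).
Proof.
move=> cz a; have := congr1 D (cz a); rewrite !lie_elt_leibniz cz addrC.
by move/addrI.
Qed.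

Lemma dform_eqP (w v : dform) : (forall D, w D = v D) -> w = v.
Proof. by move=> wv; apply/val_inj/funext. Qed.

(** On a sum of terms [a db], central coefficients slide past [a]. Unlike the defining property of
    [Omega1bar], this does not ask [z1 F1] and [z2 F2] to lie in [g] separately, which matters since
    [g] need not be a module over the center. *)
Lemma dform_central_comb w z1 z2 F F1 F2 :
  alg_center z1 -> alg_center z2 ->
  (forall b, F b = z1 * F1 b + z2 * F2 b) -> w F = z1 * w F1 + z2 * w F2.
Proof.
move=> c1 c2 FE; have [s ->] := dformP w; rewrite !fct_sumE !mulr_sumr.
rewrite -big_split; apply: eq_bigr => p _.
by rewrite /= /dform_lmul /d0 FE mulrDr !mulrA c1 c2.
Qed.

Lemma dform_lieD w D E : w (D + E) = w D + w E.
Proof. by have [+ _] := Omega1_bar (dformP w); exact. Qed.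

Lemma dform_der_zmul w z D (zD : der_zmul z D \in lie_pred g) :
  alg_center z -> w (LieElt zD) = z * w D.
Proof. by have [_ +] := Omega1_bar (dformP w); apply. Qed.

Lemma d1_lieC w D E : d1 w E D = - d1 w D E.
Proof.
rewrite /d1.
have -> : w (lie_bracket E D) = - w (lie_bracket D E).
  set B := lie_bracket D E.
  (* Coefficients -1 and 0: the second [B] is only a placeholder. *)
  rewrite [LHS](@dform_central_comb w (-1) 0 _ B B).
  - by rewrite mul0r addr0 mulN1r.
  - exact/alg_centerN/alg_center1.
  - by move=> a; rewrite mul0r mulr0.
  - by move=> b; rewrite mul0r addr0 mulN1r /= /der_comm opprB.
by rewrite !opprB opprK addrC.
Qed.

Lemma d1_lieDl w D1 D2 E : d1 w (D1 + D2) E = d1 w D1 E + d1 w D2 E.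
Proof.
rewrite /d1 dform_lieD lie_eltD.
have -> : lie_bracket (D1 + D2) E = lie_bracket D1 E + lie_bracket D2 E.
  apply/val_inj/funext => b /=; rewrite /der_comm.
  have -> : E ((D1 + D2) b) = E (D1 b) + E (D2 b) by rewrite -lie_eltD.
  by rewrite opprD addrACA.
rewrite -[(D1 + D2) (w E)]/(D1 (w E) + D2 (w E)) dform_lieD !opprD [RHS]addrACA.
by congr (_ + _); rewrite addrACA.
Qed.

Lemma d1_formD w v D E : d1 (w + v : dform) D E = d1 w D E + d1 v D E.
Proof.
have wvE F : (w + v) F = w F + v F by [].
rewrite /d1 !wvE !lie_eltD !opprD.
by rewrite [RHS]addrACA; congr (_ + _); rewrite addrACA.
Qed.

(** The defect is the value of the wedge of [da] and [w] at [D], [E]. *)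
Lemma d1_leibniz a w D E :
  d1 (a *: w : dform) D E = a * d1 w D E + D a * w E - E a * w D.
Proof.
have awE F : (a *: w) F = a * w F by [].
rewrite /d1 !awE !lie_elt_leibniz !mulrBr opprD !addrA.
by rewrite [LHS](ACl (2*4*5*1*3))/=.
Qed.

(** Here [zD, E] = z[D, E] - E(z)D with E(z) central, and the resulting E(z)w(D) cancels the one
    from differentiating z w(D) along E. *)
Lemma d1_der_zmul w z D E (zD : der_zmul z D \in lie_pred g) :
  alg_center z -> d1 w (LieElt zD) E = z * d1 w D E.
Proof.
move=> cz; rewrite /d1 dform_der_zmul// lie_elt_leibniz.
rewrite [w (lie_bracket (LieElt zD) _)](@dform_central_comb w z (- E z) _
  (lie_bracket D E) D)//.
- rewrite /= /der_zmul mulNr !opprD opprK !mulrBr !addrA.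
  by rewrite [LHS](ACl (1*3*4*(2*5)))/= addNr addr0.
- exact/alg_centerN/lie_elt_center.
move=> b; rewrite /= /der_comm /der_zmul lie_elt_leibniz mulNr mulrBr opprD.
by rewrite addrA addrAC.
Qed.

End ExteriorDerivative.

Section TorsionFreeConnections.
Context (R : realType) (A : starAlgType R) (g : starLieSubalg A).
Local Notation G := (lie_elt g).
Local Notation dform := (dform g).
Implicit Types nabla beta : dform -> G -> dform.

Lemma halfD (x : A) : (2^-1 : R[i])%:A * x + (2^-1 : R[i])%:A * x = x.
Proof.
have half2 : 2^-1 + 2^-1 = 1 :> R[i] by rewrite [RHS]splitr mul1r.
by rewrite -mulrDl -scalerDl half2 scale1r mul1r.
Qed.

Lemma halfCA (a x : A) :
  (2^-1 : R[i])%:A * (a * x) = a * ((2^-1 : R[i])%:A * x).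
Proof. by rewrite !mulr_algl scalerAr. Qed.

Lemma torsion_free_connectionD nabla beta :
  torsion_free_connections g nabla -> psi_domain g beta ->
  torsion_free_connections g (fun w D => nabla w D + beta w D).
Proof.
move=> [[[nDl nDr] nL nz] nT] [_ [bDl bDr] bL bz bW]; split; first split.
- split=> [D w v|w D E]; first by rewrite nDl bDl addrACA.
  by rewrite nDr bDr addrACA.
- by move=> a w D; rewrite nL bL scalerDr addrAC.
- by move=> w z D zD cz; rewrite nz// bz// scalerDr.
move=> w D E; rewrite -nT.
(* Vanishing wedge, read pointwise, is symmetry in the two derivations, so [beta] drops out of the
   torsion. *)
have bC : beta w D E = beta w E D.
  by have /(congr1 (fun f => f w D E))/eqP := bW; rewrite subr_eq0 => /eqP.
rewrite -[LHS]/(nabla w D E + beta w D E - (nabla w E D + beta w E D)) bC.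
by rewrite opprD addrACA subrr addr0.
Qed.

(** Equal torsions make the difference symmetric in its two derivations. Symmetry in turn yields
    regularity: sigma fixes the difference, whose values are already in [Omega1]. *)
Lemma torsion_free_connectionB nabla nabla' :
  torsion_free_connections g nabla -> torsion_free_connections g nabla' ->
  psi_domain g (fun w D => nabla w D - nabla' w D).
Proof.
move=> [[[nDl nDr] nL nz] nT] [[[mDl mDr] mL mz] mT].
set beta := fun w D => _.
have bC w D E : beta w D E = beta w E D.
  have BE F F' : beta w F F' = nabla w F F' - nabla' w F F' by [].
  have /eqP := etrans (nT w D E) (esym (mT w D E)).
  rewrite !BE subr_eq => /eqP ->.
  by rewrite [LHS](ACl (3*2*(1*4)))/= subrr addr0.
split.
- move=> w D; have -> : op_sigma beta w D = beta w D.
    by apply/funext => E; rewrite /op_sigma bC.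
  exact: dformP.
- split=> [D w v|w D E]; first by rewrite /beta nDl mDl opprD addrACA.
  by rewrite /beta nDr mDr opprD addrACA.
- by move=> a w D; rewrite /beta nL mL scalerBr opprD addrACA subrr addr0.
- by move=> w z D zD cz; rewrite /beta nz// mz// scalerBr.
apply/funext => w; apply/funext => D; apply/funext => E.
by apply/eqP; rewrite subr_eq0 /op_sigma bC.
Qed.

Context (nabla0 : dform -> G -> dform) (reg : regular nabla0).

Local Notation psi0 := (psi reg (fun=> fun=> 0)).

Lemma psi0E w D E : psi0 w D E =
  (2^-1 : R[i])%:A * (d1 w D E + (nabla0 w D E + nabla0 w E D)).
Proof. by rewrite /psi addr0. Qed.

Lemma psi0_torsion_free_connection :
  left_connection nabla0 -> torsion_free_connections g psi0.
Proof.
move=> [[nDl nDr] nL nz]; split; first split.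
- split=> [D w v|w D1 D2]; apply/dform_eqP => E.
    rewrite -[RHS]/(psi0 w D E + psi0 v D E) !psi0E.
    rewrite d1_formD !nDl -mulrDr.
    congr (_ * _).
    by rewrite [RHS]addrACA; congr (_ + _); rewrite addrACA.
  rewrite -[RHS]/(psi0 w D1 E + psi0 w D2 E) !psi0E.
  rewrite d1_lieDl nDr dform_lieD -mulrDr.
  congr (_ * _).
  by rewrite [RHS]addrACA; congr (_ + _); rewrite addrACA.
- move=> a w D; apply/dform_eqP => E.
  rewrite -[RHS]/(a * psi0 w D E + D a * w E) !psi0E d1_leibniz !nL.
  rewrite -[X in _ * (_ + X)]/(a * nabla0 w D E + D a * w E
    + (a * nabla0 w E D + E a * w D)).
  (* The two terms [E a * w D], from [d] and from sigma of [nabla0], cancel. Two copies of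
     [D a * w E] remain, matched by writing the Leibniz term on the right as two halves. *)
  rewrite -halfCA -[D a * w E in RHS]halfD -!mulrDr; congr (_ * _).
  rewrite !mulrDr !addrA [LHS](ACl (1*4*6*2*5*(3*7)))/=.
  by rewrite addNr addr0.
- move=> w z D zD cz; apply/dform_eqP => E.
  (* For sigma of [nabla0], homogeneity in [z] is that of the form [nabla0 w E]. *)
  rewrite -[RHS]/(z * psi0 w D E) !psi0E d1_der_zmul// nz// dform_der_zmul//.
  by rewrite -halfCA !mulrDr.
move=> w D E; rewrite !psi0E (d1_lieC _ _ _ w D E) -mulrBr.
rewrite [nabla0 w E D + _]addrC opprD opprK addrACA subrr addr0.
by rewrite mulrDr halfD.
Qed.

End TorsionFreeConnections.

Theorem proposition6p5 (R : realType) (A : starAlgType R)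
    (g : starLieSubalg A) (calc : derivation_based_calculus g)
    (nabla0 : dform g -> lie_elt g -> dform g)
    (conn : left_connection nabla0) (reg : regular nabla0) :
  set_bij (psi_domain g) (torsion_free_connections g) (psi reg).
Proof.
have psi0 := psi0_torsion_free_connection _ _ _ _ reg conn.
(* [psi] is translation by its value at zero, so injectivity is cancellation and preimages are
   differences. *)
have psiE beta : psi reg beta =
    (fun w D => psi reg (fun=> fun=> 0) w D + beta w D).
  by apply/funext => w; apply/funext => D; rewrite /psi addr0.
split.
- by move=> beta Bbeta; rewrite psiE; exact: torsion_free_connectionD.
- move=> beta beta' _ _; rewrite (psiE beta) (psiE beta') => eq_psi.
  apply/funext => w; apply/funext => D.
  by have /(congr1 (fun f => f w D))/addrI := eq_psi.
move=> nabla nablaT.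
exists (fun w D => nabla w D - psi reg (fun=> fun=> 0) w D).
  exact: torsion_free_connectionB.
by rewrite psiE; apply/funext => w; apply/funext => D; rewrite addrC subrK.
Qed.
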